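(* Let $C\in\mathbb{R}$ and let $$R(z;C)=\frac{1+z\left[\frac16+\frac72C+\left(\frac23-10C\right)G(z)\right]+Cz^2\left[1-G(z)\right]}{1-\left(\frac16+\frac{13}{2}C\right)z+\frac32Cz^2},\qquad G(z)=\frac{1+\frac z4+\frac{z^2}{48}}{1-\frac z4+\frac{z^2}{48}},$$ for complex $z$. Then $$\sup_{y\in\mathbb{R}}|R(iy;C)|\le 1$$ if and only if $$C\in\left[\frac{25-\sqrt{105}}{780},\ \frac{25+\sqrt{105}}{780}\right].$$
   Context: $R(z;C)$ is the amplification factor of the implicit two-stage fourth-order scheme (with its second parameter $D=-C$) applied to the scalar test equation $u_t=\lambda u$ with $z=\lambda\Delta t$, i.e. $u^{n+1}=R(z;C)u^n$. Here $i$ is the imaginary unit. *)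

(* Defs.v *)
From Stdlib Require Export Reals.
From Coquelicot Require Export Coquelicot.

Open Scope R_scope.

(* The type [C] of complex numbers is Coquelicot's; the real parameter called
   C in the mathematical statement is written [c]. *)

(* Division by zero in [C] is total.  The convention is immaterial on the
   imaginary axis, where the denominators of [G] and of [Rfac c] never
   vanish. *)

Definition G (z : C) : C :=
  ((1 + z / 4 + z ^ 2 / 48) / (1 - z / 4 + z ^ 2 / 48))%C.

Definition Rfac (c : R) (z : C) : C :=
  ((1 + z * (1 / 6 + 7 / 2 * c + (2 / 3 - 10 * c) * G z)
      + c * z ^ 2 * (1 - G z))
   / (1 - (1 / 6 + 13 / 2 * c) * z + 3 / 2 * c * z ^ 2))%C.

(* Main.v *)
(* On the imaginary axis the denominator of [G] is the conjugate of its
   numerator, so the sign of |denominator|^2 - |numerator|^2 for [Rfac] decides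
   the bound.  The order conditions make that difference vanish to order y^6,
   and it equals y^6 ((-1 + 75 c - 1170 c^2) / 3456 + c^2 y^2 / 1024).  It is
   nonnegative for all y exactly when its y^6 coefficient is, and the roots of
   that quadratic in c are (25 +- sqrt 105) / 780. *)

Require Import Defs.
From Stdlib Require Import Lra.

Lemma Cmod_sqr (z : C) : (Cmod z)² = (fst z)² + (snd z)².
Proof.
  unfold Cmod, Rsqr. rewrite sqrt_sqrt; [ring | nra].
Qed.

Lemma Cmod_div_le_1 (p q : C) :
  q <> 0%C -> Cmod (p / q) <= 1 <-> (Cmod p)² <= (Cmod q)².
Proof.
  intros hq. rewrite Cmod_div by exact hq.
  assert (hq0 : 0 < Cmod q) by (apply Cmod_gt_0; exact hq).
  assert (hp0 := Cmod_ge_0 p).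
  rewrite (Rle_div_l _ 1 _ hq0), Rmult_1_l.
  split; intros h; [apply Rsqr_incr_1 | apply Rsqr_incr_0]; lra.
Qed.

(** The imaginary part [- y / 4] vanishes only at [y = 0], where the real part is 1. *)
Lemma G_den_imag_neq_0 (y : R) :
  (1 - Ci * RtoC y / 4 + (Ci * RtoC y) ^ 2 / 48)%C <> 0%C.
Proof.
  replace (1 - Ci * RtoC y / 4 + (Ci * RtoC y) ^ 2 / 48)%C
    with ((1 - y ^ 2 / 48, - y / 4) : C).
  - intros h. injection h as h1 h2. nra.
  - apply injective_projections; simpl; field.
Qed.

Lemma Rfac_den_imag_neq_0 (c y : R) :
  (1 - (1 / 6 + 13 / 2 * c) * (Ci * RtoC y)
     + 3 / 2 * c * (Ci * RtoC y) ^ 2)%C <> 0%C.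
Proof.
  replace (1 - (1 / 6 + 13 / 2 * c) * (Ci * RtoC y)
             + 3 / 2 * c * (Ci * RtoC y) ^ 2)%C
    with ((1 - 3 / 2 * c * y ^ 2, - (1 / 6 + 13 / 2 * c) * y) : C).
  - intros h. injection h as h1 h2.
    (* Either [y = 0], with real part 1, or [c = -1/39], with real part [1 + y ^ 2 / 26]. *)
    destruct (Rmult_integral _ _ h2) as [h3 | h3].
    + assert (c = - / 39) by lra. subst c. nra.
    + subst y. lra.
  - apply injective_projections; simpl; field.
Qed.

Lemma Cmod_Rfac_imag_le_1 (c y : R) :
  Cmod (Rfac c (Ci * RtoC y)) <= 1 <->
  0 <= y ^ 6 * ((-1 + 75 * c - 1170 * c ^ 2) / 3456 + c ^ 2 * y ^ 2 / 1024).
Proof.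
  assert (hM := G_den_imag_neq_0 y).
  assert (hQ := Rfac_den_imag_neq_0 c y).
  unfold Rfac, G.
  set (z := (Ci * RtoC y)%C) in *.
  set (N := (1 + z / 4 + z ^ 2 / 48)%C).
  set (M := (1 - z / 4 + z ^ 2 / 48)%C) in *.
  set (Q := (1 - (1 / 6 + 13 / 2 * c) * z + 3 / 2 * c * z ^ 2)%C) in *.
  (* [P] is the numerator of [Rfac] multiplied by [M], which clears the denominator of [G]. *)
  set (P := ((1 + (1 / 6 + 7 / 2 * c) * z + c * z ^ 2) * M
             + ((2 / 3 - 10 * c) * z - c * z ^ 2) * N)%C).
  match goal with |- Cmod ?w <= 1 <-> _ => replace w with (P / (Q * M))%C end.
  2: { assert (h : (N / M * M = N)%C) by (field; exact hM).
       unfold P. rewrite <- h at 1. generalize (N / M)%C. intros g.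
       field. split; assumption. }
  rewrite Cmod_div_le_1 by (apply Cmult_neq_0; assumption).
  assert (hD : (Cmod (Q * M))² - (Cmod P)² =
    y ^ 6 * ((-1 + 75 * c - 1170 * c ^ 2) / 3456 + c ^ 2 * y ^ 2 / 1024)).
  { rewrite !Cmod_sqr. unfold P, Q, M, N, z, Rsqr. simpl. field. }
  rewrite <- hD. lra.
Qed.

Lemma quadratic_nonneg_iff (c : R) :
  0 <= -1 + 75 * c - 1170 * c ^ 2 <->
  (25 - sqrt 105) / 780 <= c <= (25 + sqrt 105) / 780.
Proof.
  assert (hs : sqrt 105 * sqrt 105 = 105) by (apply sqrt_sqrt; lra).
  assert (hp := sqrt_pos 105).
  set (s := sqrt 105) in *.
  assert (hf : -1 + 75 * c - 1170 * c ^ 2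
               = 1170 * ((c - (25 - s) / 780) * ((25 + s) / 780 - c))) by nra.
  (* The two linear factors add up to [s / 390 >= 0]: if one is negative, the other is positive. *)
  rewrite hf. split; [intros h; split | intros [h1 h2]]; nra.
Qed.

(** If [a < 0], a small nonzero [y] makes the second factor negative while [y ^ 6 > 0]. *)
Lemma poly_nonneg_iff (a b : R) :
  0 <= b -> (forall y : R, 0 <= y ^ 6 * (a + b * y ^ 2)) <-> 0 <= a.
Proof.
  intros hb. split.
  - intros h. destruct (Rle_or_lt 0 a) as [ha | ha]; [exact ha | exfalso].
    (* This value of [y ^ 2] solves [a + b * t = - t]; dividing by [b + 1] also covers [b = 0]. *)
    set (t := - a / (b + 1)).
    assert (ht : 0 < t) by (apply Rdiv_lt_0_compat; lra).
    assert (hbt : a + b * t = - t) by (unfold t; field; lra).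
    specialize (h (sqrt t)).
    replace (sqrt t ^ 6) with ((sqrt t ^ 2) ^ 3) in h by ring.
    rewrite pow2_sqrt, hbt in h by lra.
    assert (0 < t ^ 3) by (apply pow_lt; exact ht).
    nra.
  - intros ha y. replace (y ^ 6) with ((y ^ 3) ^ 2) by ring.
    apply Rmult_le_pos; [apply pow2_ge_0 |].
    assert (h := pow2_ge_0 y). nra.
Qed.

(** Reduces the bound on the supremum to a pointwise bound, with no need to know that the supremum
    is finite or attained. *)
Lemma Lub_Rbar_le_iff (E : R -> Prop) (l : Rbar) :
  Rbar_le (Lub_Rbar E) l <-> forall x : R, E x -> Rbar_le x l.
Proof.
  destruct (Lub_Rbar_correct E) as [hub hleast]. split.
  - intros h x hx. apply Rbar_le_trans with (Lub_Rbar E); [exact (hub x hx) | exact h].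
  - intros h. apply hleast. exact h.
Qed.

Theorem lemma3p3 (c : R) :
  Rbar_le (Lub_Rbar (fun r : R => exists y : R, r = Cmod (Rfac c (Ci * RtoC y)%C)))
          (Finite 1)
  <->
  (25 - sqrt 105) / 780 <= c <= (25 + sqrt 105) / 780.
Proof.
  rewrite Lub_Rbar_le_iff, <- quadratic_nonneg_iff.
  assert (hb : 0 <= c ^ 2 / 1024) by (assert (h := pow2_ge_0 c); lra).
  assert (hpoly := poly_nonneg_iff ((-1 + 75 * c - 1170 * c ^ 2) / 3456) _ hb).
  assert (hy : forall y : R, Cmod (Rfac c (Ci * RtoC y)) <= 1 <->
    0 <= y ^ 6 * ((-1 + 75 * c - 1170 * c ^ 2) / 3456 + c ^ 2 / 1024 * y ^ 2)).
  { intros y. rewrite Cmod_Rfac_imag_le_1.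
    replace (c ^ 2 / 1024 * y ^ 2) with (c ^ 2 * y ^ 2 / 1024) by field.
    reflexivity. }
  split.
  - intros h.
    enough (0 <= (-1 + 75 * c - 1170 * c ^ 2) / 3456) by lra.
    apply hpoly. intros y. apply hy. apply (h (Cmod (Rfac c (Ci * RtoC y)))).
    exists y. reflexivity.
  - intros h x [y ->]. apply hy, hpoly. lra.
Qed.
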